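(* There is a polynomial-time algorithm which, given a finite simple $4$-regular graph $G$, decides whether $G$ is $1/2$-tough.
   Context: All graphs are finite, simple and undirected; $\omega(H)$ denotes the number of connected components of $H$. For a real $t$, a graph $G$ is $t$-tough if $|S|\ge t\,\omega(G-S)$ for every $S\subseteq V(G)$ with $\omega(G-S)>1$. *)

(* Defs.v *)
From HB Require Import structures.
From mathcomp Require Import all_boot all_order all_algebra.
From mathcomp Require Import reals.

Set Implicit Arguments.
Unset Strict Implicit.
Unset Printing Implicit Defensive.

Import GRing.Theory Num.Theory.
Local Open Scope ring_scope.

Record sgraph := SGraph {
  vertex :> finType;
  adj : rel vertex;
  adj_sym : symmetric adj;
  adj_irr : irreflexive adj
}.

Definition regular (r : nat) (G : sgraph) : Prop :=
  forall v : G, #|[set u : G | adj v u]| = r.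

Definition omega (G : sgraph) : nat := n_comp (@adj G) G.

Section DeleteVertices.
Variables (G : sgraph) (S : {set G}).

Definition del_vertex : finType := {x : G | x \notin S}.
Definition del_adj : rel del_vertex := [rel x y | adj (val x) (val y)].

Fact del_adj_sym : symmetric del_adj.
Proof. by move=> x y; apply: adj_sym. Qed.

Fact del_adj_irr : irreflexive del_adj.
Proof. by move=> x; apply: adj_irr. Qed.

Definition delete : sgraph := SGraph del_adj_sym del_adj_irr.

End DeleteVertices.

Definition tough (R : realType) (t : R) (G : sgraph) : Prop :=
  forall S : {set G}, (1 < omega (delete S))%N ->
    t * (omega (delete S))%:R <= #|S|%:R.

(* Deterministic Turing machines with several two-way infinite tapes and
   input alphabet bool.  The tape symbols are the blank [None], the input
   bits [Some (inl b)] and the work symbols [Some (inr g)].  A state [q] is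
   halting when [tm_output q] is [Some b], the machine then answering [b]. *)

Inductive move := MoveLeft | Stay | MoveRight.

Definition symbol (W : finType) : finType := option (bool + W)%type.

Record machine := Machine {
  tm_state : finType;
  tm_work : finType;
  tm_tapes : nat;  (* number of tapes besides the input tape *)
  tm_start : tm_state;
  tm_output : tm_state -> option bool;
  tm_trans : tm_state -> tm_tapes.+1.-tuple (symbol tm_work) ->
             tm_state * tm_tapes.+1.-tuple (symbol tm_work * move)
}.

(* The symbols to the left of the head are listed from the head outwards;
   every cell beyond the two lists is blank. *)
Record tape (W : finType) := Tape {
  tape_left : seq (symbol W);
  tape_head : symbol W;
  tape_right : seq (symbol W)
}.

Definition write_move (W : finType) (t : tape W) (a : symbol W * move) :
    tape W :=
  let: Tape l _ r := t in
  let: (s, m) := a in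
  match m with
  | MoveLeft => Tape (behead l) (head None l) (s :: r)
  | Stay => Tape l s r
  | MoveRight => Tape (s :: l) (head None r) (behead r)
  end.

Definition blank_tape (W : finType) : tape W := Tape [::] None [::].

Definition input_tape (W : finType) (w : seq bool) : tape W :=
  let s := [seq Some (inl b) | b <- w] in
  Tape [::] (head None s) (behead s).

Section Run.
Variable M : machine.

Record config := Config {
  cfg_state : tm_state M;
  cfg_tapes : (tm_tapes M).+1.-tuple (tape (tm_work M))
}.

Definition init (w : seq bool) : config :=
  Config (tm_start M)
    [tuple of input_tape (tm_work M) w
              :: nseq (tm_tapes M) (blank_tape (tm_work M))].

Definition step (c : config) : config :=
  let: Config q ts := c in
  if tm_output q is Some _ then c else
  let: (q', acts) := tm_trans q [tuple of map (@tape_head _) ts] in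
  Config q' [tuple write_move (tnth ts i) (tnth acts i) | i < _].

Definition answers_within (w : seq bool) (n : nat) (b : bool) : Prop :=
  tm_output (cfg_state (iter n step (init w))) = Some b.

End Run.

(* Decidability in polynomial time of the problem "given [x] such that
   [instance x], does [yes x] hold?"; nothing is required of the machine on
   words which do not encode an instance.  Halting configurations are fixed
   by [step], so [answers_within] is a bound on the running time. *)
Definition polytime_decidable (X : Type) (encode : X -> seq bool)
    (instance yes : X -> Prop) : Prop :=
  exists (M : machine) (p : {poly nat}), forall x, instance x ->
    exists b : bool,
      answers_within M (encode x) p.[size (encode x)] b /\ (b <-> yes x).

(* The number of vertices in unary, a separator, then the adjacency matrix row
   by row.  Since the vertex type ranges over all finite types, every ordering
   of the vertices of a graph occurs as some [enum]. *)
Definition encode_graph (G : sgraph) : seq bool :=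
  nseq #|G| true ++ false :: [seq adj x y | x <- enum G, y <- enum G].

(* Main.v *)
(* A 4-regular graph G is 1/2-tough if and only if it is connected or empty.
   Deleting the empty set shows that connectedness is needed.  Conversely, let
   G be connected and G - S disconnected.  The number of edges leaving a
   component K of G - S is 4|K| minus twice the number of edges inside K, hence
   even, and it is not 0 as G is connected; all these edges end in S, which
   emits at most 4|S| edges, so that G - S has at most 2|S| components.
   Connectedness is decided by spreading marks from the first vertex along the
   edges, in as many sweeps over the adjacency matrix as there are vertices
   (and one more). *)
Require Import Defs.
From HB Require Import structures.
From mathcomp Require Import all_boot all_order all_algebra.
From mathcomp Require Import reals.
From mathcomp Require Import zify.

Set Implicit Arguments.
Unset Strict Implicit.
Unset Printing Implicit Defensive.

(** * Toughness and connectedness *)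

(** The diagonal vanishes, and by symmetry the pairs on either side of it, compared by [enum_rank],
    have equal sums. *)
Lemma sum_sym_even (T : finType) (F : T -> T -> nat) :
    (forall x y, F x y = F y x) -> (forall x, F x x = 0) ->
  ~~ odd (\sum_x \sum_y F x y).
Proof.
move=> Fsym Firr.
pose lt (x y : T) := enum_rank x < enum_rank y.
have -> : \sum_x \sum_y F x y =
    \sum_x \sum_y lt x y * F x y + \sum_x \sum_y lt y x * F x y.
  rewrite -big_split; apply: eq_bigr => x _; rewrite -big_split.
  apply: eq_bigr => y _ /=; rewrite /lt.
  case: ltngtP => [_|_|/val_inj/enum_rank_inj->]; by rewrite ?Firr; lia.
rewrite [X in _ + X]exchange_big /=.
under [X in _ + X]eq_bigr => x _ do under eq_bigr => y _ do rewrite Fsym.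
by rewrite addnn odd_double.
Qed.

Section Cuts.
Variable G : sgraph.

Definition cut (K : {set G}) : nat := \sum_(x in K) #|[set y | adj x y] :\: K|.

(** The degrees over [K] have an even sum, from which the edges inside [K], each counted from both
    ends, are taken away. *)
Lemma cut_even d (K : {set G}) : ~~ odd d -> regular d G -> ~~ odd (cut K).
Proof.
move=> d_even dG.
have inner_even : ~~ odd (\sum_(x in K) #|[set y | adj x y] :&: K|).
  have -> : \sum_(x in K) #|[set y | adj x y] :&: K| =
      \sum_x \sum_y [&& x \in K, y \in K & adj x y].
    rewrite big_mkcond; apply: eq_bigr => x _; case: ifP => xK; last first.
      by rewrite big1.
    rewrite -sum1_card big_mkcond; apply: eq_bigr => y _.
    by rewrite !inE [adj x y && _]andbC; case: (_ && _).
  apply: sum_sym_even => [x y|x]; last by rewrite adj_irr !andbF.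
  by rewrite adj_sym andbCA.
have : ~~ odd (#|K| * d) by rewrite oddM negb_and d_even orbT.
rewrite -sum_nat_const (eq_bigr (fun x => #|[set y | adj x y] :&: K| +
    #|[set y | adj x y] :\: K|)); last by move=> x _; rewrite cardsID dG.
by rewrite big_split /= oddD (negbTE inner_even).
Qed.

Lemma cut0_full (K : {set G}) x y :
  cut K = 0 -> x \in K -> connect (@adj G) x y -> y \in K.
Proof.
move=> /eqP; rewrite sum_nat_eq0 => /forallP K0 xK /connectP [p + ->].
elim: p x xK => //= z p IHp x xK /andP[xz zp]; apply: IHp zp.
have := implyP (K0 x) xK; rewrite cards_eq0 setD_eq0 => /subsetP; apply.
by rewrite inE.
Qed.

End Cuts.

Lemma omega_delete_le (G : sgraph) (S : {set G}) :
    regular 4 G -> (forall x y : G, connect (@adj G) x y) ->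
  1 < omega (delete S) -> omega (delete S) <= #|S|.*2.
Proof.
move=> G4 Gconn om_gt1.
pose e := @adj (delete S); pose rt := fingraph.root e.
have esym : connect_sym e by apply/sym_connect_sym/adj_sym.
(* For a root [c] this is the component of [c], moved back into [G]. *)
pose K c : {set G} := [set val v | v : delete S & rt v == c].
pose phi (x : G) := \sum_(s in S) adj x s.
have rt_adj (u v : delete S) : adj (val u) (val v) -> rt u = rt v.
  by move=> uv; apply/eqP; rewrite fingraph.root_connect ?connect1.
(* A neighbour outside [S] has the same root, so only edges into [S] leave a component. *)
have cutE c : cut (K c) = \sum_(x in K c) phi x.
  apply: eq_bigr => x /imsetP[v]; rewrite inE => /eqP vc ->.
  rewrite -sum1_card /phi big_mkcond [RHS]big_mkcond; apply: eq_bigr => y _.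
  rewrite !inE; have [yS | yS] := boolP (y \in S).
    have -> : y \in K c = false.
      by apply/imsetP => -[w _ yw]; move: (valP w); rewrite -yw yS.
    by case: adj.
  case vy: adj; last by rewrite andbF.
  rewrite andbT; case: ifP => // /negP[]; apply/imsetP.
  exists (Sub y yS); last by rewrite SubK.
  by rewrite inE -vc eq_sym; apply/eqP/rt_adj; rewrite SubK.
(* By parity only an empty cut is to be excluded. As [G] is connected, the component of [c] would
   then be everything and [c] the only root. *)
have cut_ge2 c : c \in roots e -> 2 <= cut (K c).
  move=> cr; have := @cut_even G 4 (K c) isT G4.
  case cut0: (cut (K c)) => [|[|m]] // _.
  have cK : \val c \in K c by apply/imsetP; exists c; rewrite ?inE // /rt (eqP cr).
  suff : omega (delete S) <= 1 by rewrite leqNgt om_gt1.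
  rewrite /omega /n_comp_mem -(card1 c); apply/subset_leq_card/subsetP => d.
  rewrite !inE => /andP[dr _].
  have /imsetP[w] := cut0_full cut0 cK (Gconn (val c) (val d)).
  by rewrite inE => /eqP wc /val_inj dw; rewrite -(eqP dr) -wc dw.
(* The components partition the complement of [S]. Enlarging the sum of [phi] to all of [G] and
   exchanging sums leaves the degrees of the vertices of [S]. *)
have le_sum : \sum_(c in roots e) cut (K c) <= #|S| * 4.
  have -> : \sum_(c in roots e) cut (K c) = \sum_(v : delete S) phi (val v).
    rewrite [RHS](partition_big rt (fun c => c \in roots e)) /=; last first.
      by move=> v _; apply: roots_root.
    apply: eq_bigr => c _; rewrite cutE big_imset /=; last by move=> ? ? _ _ /val_inj.
    by apply: eq_bigl => v; rewrite inE.
  apply: (@leq_trans (\sum_(x : G) phi x)).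
    have -> : \sum_(v : delete S) phi (val v) =
        \sum_(x in [set val v | v : delete S]) phi x.
      rewrite big_imset /=; first by apply: eq_bigl => v.
      by move=> ? ? _ _ /val_inj.
    rewrite [leqLHS]big_mkcond; apply: leq_sum => x _; by case: ifP.
  rewrite exchange_big -sum_nat_const; apply: leq_sum => s _.
  rewrite -(G4 s) -sum1_card [leqRHS]big_mkcond; apply: leq_sum => x _.
  by rewrite inE adj_sym; case: adj.
have : #|roots e| * 2 <= #|S| * 4.
  by apply: leq_trans le_sum; rewrite -sum_nat_const; apply: leq_sum.
have -> : omega (delete S) = #|roots e|.
  by apply: eq_card => x; rewrite !inE andbT.
lia.
Qed.

Lemma tough_half_connected (R : realType) (G : sgraph) : regular 4 G ->
  (forall x y : G, connect (@adj G) x y) <-> tough (1 / 2 : R)%R G.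
Proof.
move=> G4; split=> [Gconn S om_gt1 | tG x y].
  have := omega_delete_le G4 Gconn om_gt1.
  rewrite -(Num.Theory.ler_nat R) -muln2 GRing.natrM => le.
  by rewrite GRing.mul1r GRing.mulrC Num.Theory.ler_pdivrMr ?Num.Theory.ltr0n.
pose e := @adj (delete (set0 : {set G})).
have esym : connect_sym e by apply/sym_connect_sym/adj_sym.
(* For the empty set, toughness would bound half the number of components by 0. *)
have om_le1 : omega (delete (set0 : {set G})) <= 1.
  rewrite leqNgt; apply/negP => om_gt1; have := tG set0 om_gt1.
  rewrite cards0 Num.Theory.pmulr_rle0 ?Num.Theory.divr_gt0 ?Num.Theory.ltr0n //.
  by rewrite Num.Theory.lern0 => /eqP om0; rewrite om0 in om_gt1.
have no (z : G) : z \notin set0 by rewrite inE.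
pose u z : delete (set0 : {set G}) := Sub z (no z).
have : connect e (u x) (u y).
  rewrite -fingraph.root_connect //; apply/eqP.
  have /card_le1_eqP := om_le1; apply; rewrite !inE ?roots_root //.
case/connectP => p /= pp lastE; apply/connectP; exists (map val p).
  by rewrite -[x]/(val (u x)) path_map.
by rewrite -[x]/(val (u x)) last_map -lastE.
Qed.

(** * The machine *)

(* Tape 0 holds the word, tape 3 counts the sweeps.  Tapes 1 and 2 hold the
   marks: while tape 0 runs through row x of the matrix, the head of tape 1 rests
   on the mark of x and that of tape 2 runs through the vertices y.  A sweep only
   updates tape 2; [Rewind] copies it onto tape 1, whose head is aligned with
   that of tape 2 at the end of a sweep.  [Fill] erases the separator, so that
   the matrix lies between blanks. *)
Inductive state := First | Fill | Rewind | Scan | Return | Check | Halt of bool.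

Definition state_code (q : state) : bool * bool * bool :=
  match q with
  | First => (false, false, false)
  | Fill => (false, false, true)
  | Rewind => (false, true, false)
  | Scan => (false, true, true)
  | Return => (true, false, false)
  | Check => (true, false, true)
  | Halt b => (true, true, b)
  end.

Definition state_decode (c : bool * bool * bool) : state :=
  match c with
  | (false, false, false) => First
  | (false, false, true) => Fill
  | (false, true, false) => Rewind
  | (false, true, true) => Scan
  | (true, false, false) => Return
  | (true, false, true) => Check
  | (true, true, b) => Halt b
  end.

Lemma state_codeK : cancel state_code state_decode.
Proof. by case. Qed.

HB.instance Definition _ := Finite.copy state (can_type state_codeK).

Definition bit (b : bool) : symbol void := Some (inl b).

Definition is_one (a : symbol void) : bool :=
  if a is Some (inl b) then b else false.

Definition back (a : symbol void) : move := if a is None then Stay else MoveLeft.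

(** The symbols [m], [r], [c], [k] are read on tapes 0 to 3. In [Scan], a blank [c] ends a row; if
    [m] is blank too, the sweep is over, and if [k] is also blank, it was the last one. *)
Definition delta (q : state) (m r c k : symbol void) :
    state * 4.-tuple (symbol void * move) :=
  match q with
  | First =>
    if is_one m then
      (Fill, [tuple (m, MoveRight); (bit true, MoveRight);
                    (bit true, MoveRight); (bit true, MoveRight)])
    else (Halt true, [tuple (m, Stay); (r, Stay); (c, Stay); (k, Stay)])
  | Fill =>
    if is_one m then
      (Fill, [tuple (m, MoveRight); (bit false, MoveRight);
                    (bit false, MoveRight); (bit true, MoveRight)])
    else (Rewind, [tuple (None, Stay); (None, MoveLeft);
                         (None, MoveLeft); (None, MoveLeft)])
  | Rewind =>
    if (m, c) is (None, None) then
      (Scan, [tuple (None, MoveRight); (None, MoveRight);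
                    (None, MoveRight); (k, Stay)])
    else (Rewind, [tuple (m, back m); (c, back c); (c, back c); (k, Stay)])
  | Scan =>
    match c, m, k with
    | Some _, _, _ =>
      (Scan, [tuple (m, MoveRight); (r, Stay);
                    (bit (is_one c || is_one m && is_one r), MoveRight);
                    (k, Stay)])
    | None, Some _, _ =>
      (Return, [tuple (m, Stay); (r, MoveRight); (None, MoveLeft); (k, Stay)])
    | None, None, Some _ =>
      (Rewind, [tuple (None, MoveLeft); (r, Stay);
                      (None, MoveLeft); (k, MoveLeft)])
    | None, None, None =>
      (Check, [tuple (None, Stay); (r, Stay); (None, MoveLeft); (None, Stay)])
    end
  | Return =>
    if c is Some _ then
      (Return, [tuple (m, Stay); (r, Stay); (c, MoveLeft); (k, Stay)])
    else (Scan, [tuple (m, Stay); (r, Stay); (None, MoveRight); (k, Stay)])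
  | Check =>
    if c is Some _ then
      (if is_one c then Check else Halt false,
       [tuple (m, Stay); (r, Stay); (c, MoveLeft); (k, Stay)])
    else (Halt true, [tuple (m, Stay); (r, Stay); (c, Stay); (k, Stay)])
  | Halt b => (Halt b, [tuple (m, Stay); (r, Stay); (c, Stay); (k, Stay)])
  end.

Definition connectivity_machine : machine :=
  @Machine state void 3 First
    (fun q => if q is Halt b then Some b else None)
    (fun q s => delta q (nth None s 0) (nth None s 1)
                        (nth None s 2) (nth None s 3)).

Local Notation M := connectivity_machine.

(** * Configurations and time-bounded runs *)

Definition cfg (q : state) (t0 t1 t2 t3 : tape void) : config M :=
  @Config M q [tuple t0; t1; t2; t3].

(** The new tapes are variables tied by equations, so that any target configuration matches and
    computation settles the rest. *)
Lemma cfg_step q t0 t1 t2 t3 q' a0 a1 a2 a3 t0' t1' t2' t3' :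
    (if q is Halt _ then false else true) ->
    delta q (tape_head t0) (tape_head t1) (tape_head t2) (tape_head t3) =
      (q', [tuple a0; a1; a2; a3]) ->
    write_move t0 a0 = t0' -> write_move t1 a1 = t1' ->
    write_move t2 a2 = t2' -> write_move t3 a3 = t3' ->
  step (cfg q t0 t1 t2 t3) = cfg q' t0' t1' t2' t3'.
Proof.
move=> q_run dE <- <- <- <-; rewrite /step /=.
have -> : (if q is Halt b then Some b else None) = None by case: q q_run dE.
rewrite dE /cfg; congr Config; apply: eq_from_tnth => i.
by rewrite tnth_mktuple; case: i => -[|[|[|[|?]]]].
Qed.

(* The head is on the first symbol of [r]; in [at_left], on that of [l]. *)
Definition at_right (l r : seq (symbol void)) : tape void :=
  Tape l (head None r) (behead r).
Definition at_left (l r : seq (symbol void)) : tape void :=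
  Tape (behead l) (head None l) r.

(** Only an upper bound on the number of steps is kept, so that bounds add up and exact durations
    need not be found. *)
Variant runs n (c c' : config M) : Prop :=
  Runs k of k <= n & iter k (@step M) c = c'.

Lemma runs0 c : runs 0 c c. Proof. by exists 0. Qed.

Lemma runs_trans n1 n2 n c c' c'' :
  runs n1 c c' -> runs n2 c' c'' -> n1 + n2 <= n -> runs n c c''.
Proof.
move=> [k1 le1 <-] [k2 le2 <-] le_n; exists (k2 + k1); first by lia.
by rewrite iterD.
Qed.

Lemma runs_step n c c' c'' : step c = c' -> runs n c' c'' -> runs n.+1 c c''.
Proof. by move=> <- [k le_k <-]; exists k.+1; rewrite ?iterSr. Qed.

Lemma write_stay (t : tape void) : write_move t (tape_head t, Stay) = t.
Proof. by case: t. Qed.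

(** * The phases of the machine *)

Lemma runs_fill m w l0 l1 l2 l3 :
  runs m.+1
    (cfg Fill (at_right l0 (nseq m (bit true) ++ bit false :: w))
       (at_right l1 [::]) (at_right l2 [::]) (at_right l3 [::]))
    (cfg Rewind (at_left (None :: catrev (nseq m (bit true)) l0) w)
       (at_left (catrev (nseq m (bit false)) l1) [:: None])
       (at_left (catrev (nseq m (bit false)) l2) [:: None])
       (at_left (catrev (nseq m (bit true)) l3) [:: None])).
Proof.
elim: m l0 l1 l2 l3 => [|m IHm] l0 l1 l2 l3.
  by apply: runs_step (runs0 _); apply: cfg_step; reflexivity.
apply: runs_step; last exact: IHm.
by apply: cfg_step; reflexivity.
Qed.

(** Tapes 0 and 2 rewind together, the first to reach its blank waiting for the other; the sum of
    the lengths bounds their maximum. Of the old marks [v'] only the length matters, as [v]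
    overwrites them. *)
Lemma runs_rewind (u v v' : seq bool) l0 r0 l1 r1 l2 r2 t3 :
    head None l0 = None -> head None l1 = None -> head None l2 = None ->
    size v' = size v ->
  runs (size u + size v)
    (cfg Rewind (at_left (map bit u ++ l0) r0) (at_left (map bit v' ++ l1) r1)
       (at_left (map bit v ++ l2) r2) t3)
    (cfg Rewind (at_left l0 (catrev (map bit u) r0))
       (at_left l1 (catrev (map bit v) r1))
       (at_left l2 (catrev (map bit v) r2)) t3).
Proof.
move=> l0N l1N l2N.
elim: u v v' r0 r1 r2 => [|a u IHu] v; elim: v => [|b v IHv] [|b' v'] r0 r1 r2 //.
- by move=> _; apply: runs0.
- case=> sz; apply: runs_step; last exact: (IHv v').
  by apply: cfg_step; rewrite //= ?l0N ?write_stay //= /at_left l0N.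
- move=> _; apply: runs_step; last exact: (IHu [::] [::]).
  by apply: cfg_step; rewrite //= ?l2N ?write_stay //= /at_left ?l1N ?l2N.
case=> sz; apply: (runs_trans (n1 := 1)); last 2 first.
- exact: (IHu v v').
- by rewrite /=; lia.
by apply: runs_step (runs0 _); apply: cfg_step; rewrite //= write_stay.
Qed.

(** Here [a] is the row of a vertex whose mark is [b], and [f] gives the marks on tape 2. *)
Lemma runs_scan_row (T : Type) (a f : T -> bool) b (ys : seq T)
    l0 r0 l1 r1 l2 r2 t3 :
  runs (size ys)
    (cfg Scan (at_right l0 (map (bit \o a) ys ++ r0)) (at_right l1 (bit b :: r1))
       (at_right l2 (map (bit \o f) ys ++ r2)) t3)
    (cfg Scan (at_right (catrev (map (bit \o a) ys) l0) r0)
       (at_right l1 (bit b :: r1))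
       (at_right (catrev [seq bit (f y || a y && b) | y <- ys] l2) r2) t3).
Proof.
elim: ys l0 l2 => [|y ys IHys] l0 l2; first exact: runs0.
apply: runs_step; last exact: IHys.
by apply: cfg_step; rewrite //= write_stay.
Qed.

Lemma runs_return (v : seq bool) t0 t1 l2 r2 t3 : head None l2 = None ->
  runs (size v).+1
    (cfg Return t0 t1 (at_left (map bit v ++ l2) r2) t3)
    (cfg Scan t0 t1 (at_right (None :: behead l2) (catrev (map bit v) r2)) t3).
Proof.
move=> l2N; elim: v r2 => [|b v IHv] r2.
  by apply: runs_step (runs0 _); apply: cfg_step; rewrite //= ?l2N // ?write_stay.
apply: runs_step; last exact: IHv.
by apply: cfg_step; rewrite //= write_stay.
Qed.

(** This is [answers_within] from an arbitrary configuration. *)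
Definition halts_within n c b : Prop :=
  tm_output (cfg_state (iter n (@step M) c)) = Some b.

Lemma halts_within_leq m n c b :
  m <= n -> halts_within m c b -> halts_within n c b.
Proof.
move=> /subnK <-; rewrite /halts_within iterD; move: (iter m _ c) => {}c.
have halted c' : tm_output (cfg_state c') = Some b -> step c' = c'.
  by case: c' => q ts /= ->.
by move=> cb; elim: (n - m) => //= k IHk; rewrite halted.
Qed.

Lemma runs_halts n1 n2 n c c' b :
  runs n1 c c' -> halts_within n2 c' b -> n1 + n2 <= n -> halts_within n c b.
Proof.
move=> [k le_k <-] c'b le_n; apply: (@halts_within_leq (n2 + k)); first by lia.
by rewrite /halts_within iterD.
Qed.

Lemma halts_within_step n c c' b :
  step c = c' -> halts_within n c' b -> halts_within n.+1 c b.
Proof. by move=> <-; rewrite /halts_within iterSr. Qed.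

Lemma check_halts (v : seq bool) t0 t1 l2 r2 t3 : head None l2 = None ->
  halts_within (size v).+1 (cfg Check t0 t1 (at_left (map bit v ++ l2) r2) t3)
    (all id v).
Proof.
move=> l2N; elim: v t0 t1 r2 t3 => [|b v IHv] t0 t1 r2 t3.
  by apply: halts_within_step; first by apply: cfg_step; rewrite //= ?l2N //.
case: b => /=; last first.
  (* An unmarked vertex ends the check after a single step. *)
  exact: (@halts_within_leq 1).
apply: (halts_within_step _ (IHv t0 t1 (bit true :: r2) t3)).
by apply: cfg_step; rewrite //= write_stay.
Qed.

Lemma catrev_rev (T : Type) (s r : seq T) : catrev (rev s) r = s ++ r.
Proof. by rewrite catrevE revK. Qed.

Lemma runs_rewind_all (u v v' : seq bool) l0 r0 l1 r1 l2 r2 t3 :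
    head None l0 = None -> head None l1 = None -> head None l2 = None ->
    size v' = size v ->
  runs (size u + size v).+1
    (cfg Rewind (at_left (map bit u ++ l0) r0) (at_left (map bit v' ++ l1) r1)
       (at_left (map bit v ++ l2) r2) t3)
    (cfg Scan (at_right (None :: behead l0) (catrev (map bit u) r0))
       (at_right (None :: behead l1) (catrev (map bit v) r1))
       (at_right (None :: behead l2) (catrev (map bit v) r2)) t3).
Proof.
move=> l0N l1N l2N sz.
rewrite -addn1; apply: (runs_trans (runs_rewind u r0 r1 r2 t3 l0N l1N l2N sz)).
2: exact: leqnn.
apply: runs_step (runs0 _).
by apply: cfg_step; rewrite //= ?l0N ?l2N // ?write_stay.
Qed.

(** * Sweeps over the adjacency matrix *)

Section Rounds.
Variables (T : Type) (A : T -> T -> bool).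

(** One synchronous round of breadth-first search: the old marks [f] are read throughout, as on tape
    1. *)
Definition spread (xs : seq T) (f : T -> bool) (y : T) : bool :=
  f y || has (fun x => A x y && f x) xs.

(** The old marks [f] stay fixed while [g] changes from row to row. A row costs one scan, one step
    into [Return] and the way back. The last row is the base case, since tape 1 then stays on its
    last mark. *)
Lemma runs_scan x xs ys (f g : T -> bool) l0 r0 l1 r1 t3 : 0 < size ys ->
  runs ((size xs).+1 * (2 * size ys + 2))
    (cfg Scan (at_right l0 (map bit (allpairs A (x :: xs) ys) ++ r0))
       (at_right l1 (map (bit \o f) (x :: xs) ++ r1))
       (at_right [:: None] (map (bit \o g) ys ++ [:: None])) t3)
    (cfg Scan (at_right (catrev (map bit (allpairs A (x :: xs) ys)) l0) r0)
       (at_left (catrev (map (bit \o f) (x :: xs)) l1) r1)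
       (at_right (catrev
         [seq bit (g y || has (fun x => A x y && f x) (x :: xs)) | y <- ys]
         [:: None]) [:: None]) t3).
Proof.
move=> ys_gt0; elim: xs x g l0 l1 => [|x' xs IHxs] x g l0 l1.
  have -> : [seq bit (g y || has (fun x => A x y && f x) [:: x]) | y <- ys] =
      [seq bit (g y || A x y && f x) | y <- ys].
    by apply: eq_map => y /=; rewrite orbF.
  rewrite [allpairs _ _ _]cats0 -map_comp.
  apply: (runs_trans (runs_scan_row _ _ _ _ _ _ _ _ _ _ _) (runs0 _)); lia.
pose h y := g y || A x y && f x.
have -> : map bit (allpairs A [:: x, x' & xs] ys) =
    map (bit \o A x) ys ++ map bit (allpairs A (x' :: xs) ys).
  by rewrite map_comp -map_cat.
rewrite -catA; set w := map bit (allpairs A (x' :: xs) ys) ++ r0.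
(* Another row follows and is not empty, so the machine sees a bit on tape 0 and enters [Return]. *)
have [b wb] : exists b, head None w = bit b.
  by rewrite /w; case: ys ys_gt0 {w IHxs h} => // y ys _; exists (A x' y).
apply: (runs_trans (runs_scan_row _ _ _ _ _ _ _ _ _ _ _)).
- have -> : catrev [seq bit (g y || A x y && f x) | y <- ys] [:: None] =
      map bit (rev (map h ys)) ++ [:: None].
    by rewrite catrevE map_rev -map_comp.
  apply: (runs_step (c' := cfg Return (at_right (catrev (map (bit \o A x) ys) l0) w)
      (at_right (bit (f x) :: l1) (map (bit \o f) (x' :: xs) ++ r1))
      (at_left (map bit (rev (map h ys)) ++ [:: None]) [:: None]) t3)).
    by apply: cfg_step; rewrite //= ?wb //= ?write_stay // /at_right wb.
  refine (runs_trans (@runs_return _ _ _ [:: None] _ _ erefl) _ (leqnn _)).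
  have -> : catrev (map bit (rev (map h ys))) [:: None] =
      map (bit \o h) ys ++ [:: None].
    by rewrite map_rev catrevE revK -map_comp.
  rewrite catrev_catl.
  have -> : [seq bit (g y || has (fun x => A x y && f x) [:: x, x' & xs]) | y <- ys] =
      [seq bit (h y || has (fun x => A x y && f x) (x' :: xs)) | y <- ys].
    by apply: eq_map => y; rewrite /h /= orbA.
  exact: IHxs.
- by rewrite size_rev size_map /=; lia.
Qed.

(** The list [p] will be the unary vertex count, cut off by the erased separator. *)
Definition scan_start ys (f : T -> bool) p r0 t3 : config M :=
  cfg Scan (at_right (None :: p) (map bit (allpairs A ys ys) ++ r0))
    (at_right [:: None] (map (bit \o f) ys ++ [:: None]))
    (at_right [:: None] (map (bit \o f) ys ++ [:: None])) t3.

(** The summands are the sweep, the rewinding of the matrix and of the marks, and the steps into and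
    out of [Rewind]. *)
Definition round_time n := n * (2 * n + 2) + n * n + n + 2.

Lemma runs_round ys f p r0 l3 r3 : 0 < size ys -> head None r0 = None ->
  runs (round_time (size ys))
    (scan_start ys f p r0 (at_left (bit true :: l3) r3))
    (scan_start ys (spread ys f) p (None :: behead r0)
       (at_left l3 (bit true :: r3))).
Proof.
case: ys => // x xs _ r0N; set ys := x :: xs.
apply: (runs_trans (runs_scan _ _ _ _ _ _ _ _ _ _)) => //.
- apply: (runs_step (c' := cfg Rewind
      (at_left (map bit (rev (allpairs A ys ys)) ++ None :: p) (None :: behead r0))
      (at_left (map bit (rev (map f ys)) ++ [:: None]) [:: None])
      (at_left (map bit (rev (map (spread ys f) ys)) ++ [:: None]) [:: None])
      (at_left l3 (bit true :: r3)))).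
    rewrite !catrevE !map_rev -!map_comp.
    by apply: cfg_step; rewrite //= ?r0N // ?write_stay.
  have sz : size (rev (map f ys)) = size (rev (map (spread ys f) ys)).
    by rewrite !size_rev !size_map.
  have := @runs_rewind_all (rev (allpairs A ys ys)) _ _ (None :: p)
    (None :: behead r0) [:: None] [:: None] [:: None] [:: None]
    (at_left l3 (bit true :: r3)) erefl erefl erefl sz.
  rewrite ![map bit (rev _)]map_rev !catrev_rev -!map_comp => R.
  exact: runs_trans R (runs0 _) (leqnn _).
- by rewrite !size_rev size_allpairs size_map /round_time /=; lia.
Qed.

(** Each one on tape 3 pays for a full round; the blank after them allows a last sweep followed by
    [Check], which is no longer than a rewinding. *)
Lemma rounds_halt ys f p r0 k r3 : 0 < size ys -> head None r0 = None ->
  halts_within (k.+1 * round_time (size ys))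
    (scan_start ys f p r0 (at_left (nseq k (bit true)) r3))
    (all (iter k.+1 (spread ys) f) ys).
Proof.
move=> ys_gt0; elim: k f r0 r3 => [|k IHk] f r0 r3 r0N; last first.
  rewrite iterSr; apply: runs_halts (runs_round _ _ _ _ ys_gt0 r0N) _ _.
    exact: IHk.
  by rewrite -mulSn.
case: ys ys_gt0 => // x xs _; set ys := x :: xs.
apply: (runs_halts (runs_scan _ _ _ _ _ _ _ _ _ _)) => //.
  have -> : catrev [seq bit (f y || has (fun x => A x y && f x) ys) | y <- ys]
      [:: None] = map bit (rev (map (spread ys f) ys)) ++ [:: None].
    by rewrite catrevE map_rev -map_comp.
  apply: halts_within_step; first by apply: cfg_step; rewrite //= ?r0N.
  have -> : all (iter 1 (spread ys) f) ys = all id (rev (map (spread ys f) ys)).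
    by rewrite all_rev all_map.
  exact: check_halts.
by rewrite size_rev /= size_map /round_time /=; lia.
Qed.

End Rounds.

(** * The whole run on an encoded graph *)

Lemma init_cfg s : init M s =
  cfg First (at_right [::] (map bit s))
    (at_right [::] [::]) (at_right [::] [::]) (at_right [::] [::]).
Proof. by rewrite /init /cfg; congr Config; apply: val_inj. Qed.

Lemma catrev_nseq (T : Type) n (a : T) : catrev (nseq n a) [:: a] = nseq n.+1 a.
Proof. by rewrite catrevE rev_nseq; elim: n => //= n ->. Qed.

Lemma map_pred1_notin (T : eqType) (x : T) s :
  x \notin s -> map (pred1 x) s = nseq (size s) false.
Proof.
elim: s => //= y s IHs; rewrite inE negb_or.
by move=> /andP[/negPf xy /IHs->]; rewrite eq_sym xy.
Qed.

Lemma connectivity_machine_halts (T : eqType) (A : rel T) x0 xs :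
    let V := x0 :: xs in uniq V ->
  halts_within ((2 * size V).+2 + (size V).+1 * round_time (size V))
    (init M (nseq (size V) true ++ false :: allpairs A V V))
    (all (iter (size V).+1 (spread A V) (pred1 x0)) V).
Proof.
move=> V uniqV; set m := size xs; set w := map bit (allpairs A V V).
have start : runs (2 * size V).+2 (init M (nseq (size V) true ++ false :: allpairs A V V))
    (scan_start A V (pred1 x0) (catrev (nseq m (bit true)) [:: bit true]) [::]
      (at_left (nseq m.+1 (bit true)) [:: None])).
  rewrite init_cfg map_cat map_nseq /=.
  (* Filling and the first rewinding take [m.+2] steps each, where [size V] is [m.+1]. *)
  apply: (@runs_trans m.+2 m.+2 _ _ (cfg Rewind
      (at_left (None :: catrev (nseq m (bit true)) [:: bit true]) w)
       (at_left (catrev (nseq m (bit false)) [:: bit true]) [:: None])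
       (at_left (catrev (nseq m (bit false)) [:: bit true]) [:: None])
       (at_left (catrev (nseq m (bit true)) [:: bit true]) [:: None]))).
  - apply: runs_step; last exact: runs_fill.
    by apply: cfg_step; reflexivity.
  - set v := rev (true :: nseq m false).
    have markE : map (bit \o pred1 x0) V ++ [:: None] =
        catrev (map bit v) [:: None].
      rewrite /v map_rev catrev_rev map_comp /= eqxx map_pred1_notin //.
      by case/andP: uniqV.
    have vE : catrev (nseq m (bit false)) [:: bit true] = map bit v ++ [::].
      by rewrite cats0 /v map_rev /= map_nseq.
    rewrite /scan_start markE vE catrev_nseq [map bit (allpairs _ _ _) ++ _]cats0.
    (* Tape 0 is already on the erased separator and has nothing to rewind. *)
    have -> : m.+2 = (size (Nil bool) + size v).+1.
      by rewrite /v size_rev /= size_nseq.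
    exact: (@runs_rewind_all [::] v v (None :: nseq m.+1 (bit true)) w [::]
      [:: None] [::] [:: None] (at_left (nseq m.+1 (bit true)) [:: None])
      erefl erefl erefl erefl).
  - by rewrite /=; lia.
apply: (runs_halts start); last exact: leqnn.
exact: rounds_halt.
Qed.

(** Marks travel along edges only, and the end of a path is marked after as many rounds as the path
    has edges. A path without repetition has fewer edges than there are vertices. *)
Lemma iter_spread_connected (T : finType) (e : rel T) x0 xs :
    symmetric e -> enum T = x0 :: xs ->
  all (iter (size (enum T)).+1 (spread e (enum T)) (pred1 x0)) (enum T) <->
  forall x y, connect e x y.
Proof.
move=> e_sym TE; set V := enum T.
have sound k y : iter k (spread e V) (pred1 x0) y -> connect e x0 y.
  elim: k y => [|k IHk] y; first by move=> /eqP->.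
  case/orP=> [/IHk //|/hasP[x _ /andP[xy /IHk x0x]]].
  exact: connect_trans (connect1 xy).
have grow k j y : k <= j -> iter k (spread e V) (pred1 x0) y ->
    iter j (spread e V) (pred1 x0) y.
  move=> /subnK <-; elim: (j - k) => //= i IHi /IHi.
  by rewrite /spread => ->.
have complete p : path e x0 p -> iter (size p) (spread e V) (pred1 x0) (last x0 p).
  elim/last_ind: p => [|p y IHp]; first by rewrite /= eqxx.
  rewrite rcons_path size_rcons last_rcons => /andP[/IHp px py].
  apply/orP; right; apply/hasP; exists (last x0 p); first exact: mem_enum.
  by rewrite py.
split=> [/allP reach x y|conn].
  have conn0 z : connect e x0 z by apply/sound/reach; rewrite mem_enum.
  apply: connect_trans (conn0 y).
  by rewrite (sym_connect_sym e_sym).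
apply/allP => y _; have /connectP[p pp ->] := conn x0 y.
case/shortenP: pp => q qp uq _; apply: grow (complete q qp).
have := max_card (mem (x0 :: q)); rewrite (card_uniqP uq) cardE /= -/V.
lia.
Qed.

(** * The polynomial time bound *)

Local Open Scope ring_scope.

Theorem theorem1p15 (R : realType) :
  polytime_decidable encode_graph (regular 4) (tough (1 / 2 : R)).
Proof.
(* With [n] vertices the word has length [n^2 + n + 1] and the running time is cubic in [n], so six
   times the squared length is ample. *)
exists M, ('X^2 *+ 6)%R => G G4.
case VE: (enum G) => [|x0 xs].
  (* The word of the empty graph is the separator alone, on which the machine answers at once. *)
  exists true; split.
    apply: (@halts_within_leq 1%N); last first.
      rewrite /encode_graph VE cardE VE init_cfg.
      by apply: halts_within_step; first by apply: cfg_step; reflexivity.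
    by rewrite /encode_graph VE cardE VE /= hornerMn hornerXn.
  split=> // _; apply/tough_half_connected => // x.
  by have := mem_enum G x; rewrite VE.
have uniqV : uniq (x0 :: xs) by rewrite -VE enum_uniq.
have := connectivity_machine_halts (@adj G) uniqV; rewrite -VE.
set b := all _ _ => Mb; exists b; split; last first.
  rewrite /b (iter_spread_connected (@adj_sym G) VE).
  exact: tough_half_connected.
rewrite /encode_graph cardE.
apply: halts_within_leq Mb.
rewrite size_cat size_nseq /= size_allpairs hornerMn hornerXn /round_time.
rewrite -GRing.mulr_natr !natrE; move: (size _) => n.
nia.
Qed.
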